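(* Let $X=\{x_1,\dots,x_n\}$ be a finite min-max closed subset of $\mathbb{R}^d$. If $d=2$, or if $X\subseteq\prod_{i=1}^d\{a_i,b_i\}$ for some real numbers $a_i\le b_i$ ($i=1,\dots,d$), then $X$ is $\mathrm{MTP}_2$-tidy.
   Context: For $x,y\in\mathbb{R}^d$, $x\wedge y$ and $x\vee y$ are the coordinatewise minimum and maximum. A set is min-max closed if it contains $u\wedge v$ and $u\vee v$ whenever it contains $u$ and $v$. For $y\in\mathbb{R}^n$, the tent function $h_{X,y}:\mathbb{R}^d\to\mathbb{R}\cup\{-\infty\}$ is the smallest concave function with $h_{X,y}(x_i)\ge y_i$ for all $i$; it equals $-\infty$ outside $\operatorname{conv}(X)$. A vector $y\in\mathbb{R}^n$ is supermodular (on $X$) if $y_i+y_j\le y_k+y_\ell$ whenever $x_k=x_i\wedge x_j$ and $x_\ell=x_i\vee x_j$; it is tight if $h_{X,y}(x_i)=y_i$ for all $i$. A function $g:\mathbb{R}^d\to\mathbb{R}\cup\{-\infty\}$ is supermodular if $g(x)+g(y)\le g(x\wedge y)+g(x\vee y)$ for all $x,y\in\mathbb{R}^d$. $X$ is $\mathrm{MTP}_2$-tidy if for every tight supermodular $y\in\mathbb{R}^n$ the tent function $h_{X,y}$ is supermodular. *)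

(* Defs.v *)
From HB Require Import structures.
From mathcomp Require Import all_boot all_order all_algebra.
From mathcomp Require Import all_classical all_reals all_analysis.

Set Implicit Arguments.
Unset Strict Implicit.
Unset Printing Implicit Defensive.

Import Order.TTheory GRing.Theory Num.Theory.

Local Open Scope classical_set_scope.
Local Open Scope ring_scope.
Local Open Scope convex_scope.

Section Definitions.
Context (R : realType) (d : nat).
Implicit Types (u v : 'rV[R]_d) (A : set 'rV[R]_d) (g : 'rV[R]_d -> \bar R).

Definition vmin u v : 'rV[R]_d := \row_i Num.min (u 0 i) (v 0 i).

Definition vmax u v : 'rV[R]_d := \row_i Num.max (u 0 i) (v 0 i).

Definition minmax_closed A : Prop :=
  forall u v, A u -> A v -> A (vmin u v) /\ A (vmax u v).

(* A function into R \cup {-oo} is a function into \bar R avoiding +oo.       *)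
Definition nopinfty g : Prop := forall u, g u != +oo%E.

Definition concave g : Prop :=
  forall u v (t : R), 0 < t -> t < 1 ->
    (t%:E * g u + (1 - t)%:E * g v <= g (t *: u + (1 - t) *: v)%R)%E.

Definition supermodular g : Prop :=
  forall u v, (g u + g v <= g (vmin u v) + g (vmax u v))%E.

Section Tent.
Context (n : nat).
Implicit Types (x : 'I_n -> 'rV[R]_d) (y : 'rV[R]_n).

Definition concave_majorant x y g : Prop :=
  [/\ nopinfty g, concave g & forall i, ((y 0 i)%:E <= g (x i))%E].

(* The pointwise infimum of the concave majorants; that it is itself the      *)
(* smallest one is tent_majorant and tent_smallest below.                     *)
Definition tent x y : 'rV[R]_d -> \bar R :=
  fun u => ereal_inf [set g u | g in concave_majorant x y].

Definition supermodular_vec x y : Prop :=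
  forall i j k l, x k = vmin (x i) (x j) -> x l = vmax (x i) (x j) ->
    y 0 i + y 0 j <= y 0 k + y 0 l.

Definition tight x y : Prop := forall i, tent x y (x i) = (y 0 i)%:E.

Definition MTP2_tidy x : Prop :=
  forall y, tight x y -> supermodular_vec x y -> supermodular (tent x y).

Lemma tent_smallest x y g u : concave_majorant x y g -> (tent x y u <= g u)%E.
Proof. by move=> gP; apply: ereal_inf_lbound; exists g. Qed.

(* Constant on a convex set containing the points, -oo elsewhere.             *)
Lemma indic_majorant x y A :
    (forall u v (t : R), A u -> A v -> 0 < t -> t < 1 ->
       A (t *: u + (1 - t) *: v)) ->
    (forall i, A (x i)) ->
  concave_majorant x y
    (fun u => if u \in A then (\sum_i `|y 0 i|)%:E else -oo%E).
Proof.
move=> cA Ax; split => [u|u v t t0 t1|i].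
- by case: ifP.
- have t1' : 0 < 1 - t by rewrite subr_gt0.
  case: (boolP (u \in A)) => uA; last by rewrite gt0_muleNy ?lte_fin// leNye.
  case: (boolP (v \in A)) => vA.
    rewrite mem_set; last by apply: cA => //; apply: set_mem.
    by rewrite -!EFinM -EFinD lee_fin -mulrDl addrC subrK mul1r.
  by rewrite gt0_muleNy ?lte_fin// addeNy leNye.
- rewrite mem_set// lee_fin (le_trans (ler_norm _))//.
  by rewrite (bigD1 i)//= lerDl sumr_ge0.
Qed.

Lemma tent_majorant x y : concave_majorant x y (tent x y).
Proof.
split => [u|u v t t0 t1|i].
- have := tent_smallest u (@indic_majorant x y setT ltac:(by []) ltac:(by [])).
  by rewrite in_setT; case: (tent x y u).
- apply: le_ereal_inf_tmp => _ [g gP <-].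
  have [_ + _] := gP; move=> /(_ u v t t0 t1); apply: le_trans.
  by apply: leeD; rewrite lee_pmul2l ?lte_fin ?subr_gt0//; apply: tent_smallest.
- by apply: le_ereal_inf_tmp => _ [g [_ _ gx] <-].
Qed.

Lemma tent_outside_hull x y u :
  ~ smallest (@convex_set R 'rV[R]_d) (range x) u -> tent x y u = -oo%E.
Proof.
move=> /existsNP[A /not_implyP[[cA xA] Au]].
have := tent_smallest u (@indic_majorant x y A _ _).
rewrite memNset// leeNy_eq => /(_ _ _)/eqP; apply => [v w t Av Aw t0 t1|i].
- have t01 : Itv.spec (@Itv.num_sem R) (Itv.Real `[0%Z, 1%Z]) t.
    by rewrite /= /Itv.num_sem/= num_real/= in_itv/= !ltW.
  by apply/set_mem/(cA v w (Itv.mk t01)); apply: mem_set.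
- by apply: xA; exists i.
Qed.

End Tent.
End Definitions.

(* Main.v *)
(* The tent function h is the supremum of the values of the finite probability
   measures on X with a given barycenter. Take such measures for u and v, of
   total value c, and any coupling of the two. Applying minimum and maximum to
   its pairs gives points a <= min(u,v) and b = u + v - a with
   h(a) + h(b) >= c, by supermodularity of y and concavity of h.
   If d = 2, then min(u,v) = w1 u + w2 v + w3 a for some convex weights, hence
   max(u,v) = w1 v + w2 u + w3 b, and concavity of h concludes.
   If X is two-valued in every coordinate, the coupling can be uncrossed, without
   changing its barycenter or decreasing its value, until its support is a chain
   of X * X; then a = min(u,v). *)
Require Import Defs.
From mathcomp Require Import all_boot all_order all_algebra.
From mathcomp Require Import all_classical all_reals all_analysis.
From mathcomp Require Import ring lra.

Set Implicit Arguments.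
Unset Strict Implicit.
Unset Printing Implicit Defensive.

Import Order.TTheory GRing.Theory Num.Theory.
Import numFieldNormedType.Exports.

Local Open Scope classical_set_scope.
Local Open Scope ring_scope.

(** * Finite probability distributions and Jensen's inequality *)

Definition distr (R : realType) (T : finType) (w : T -> R) : Prop :=
  (forall t, 0 <= w t) /\ \sum_t w t = 1.

(** Suprema need not be attained, so extended values are approached by reals strictly below them;
    the error [e] is shared as [e / (a + b)]. *)
Lemma lee_weighted_sum (R : realType) (a b : R) (A B C : \bar R) :
    0 < a -> 0 < b -> A != +oo%E -> B != +oo%E ->
    (forall r s, r%:E < A -> s%:E < B -> (a * r + b * s)%:E <= C)%E ->
  (a%:E * A + b%:E * B <= C)%E.
Proof.
move=> a0 b0; case: A => [r||] // _; last by rewrite gt0_muleNy ?lte_fin ?leNye.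
case: B => [s||] // _; last by rewrite gt0_muleNy ?lte_fin ?addeNy ?leNye.
move=> H; apply/lee_addgt0Pr => e e0.
have ab0 : 0 < a + b by rewrite addr_gt0.
have d0 : 0 < e / (a + b) by rewrite divr_gt0.
have := H (r - e / (a + b)) (s - e / (a + b)).
rewrite !lte_fin !gtrBl => /(_ d0 d0) /(leeD2r e%:E); apply: le_trans.
rewrite -!EFinM -!EFinD lee_fin le_eqVlt; apply/orP; left; apply/eqP.
by field; rewrite gt_eqF.
Qed.

Section Jensen.
Context (R : realType) (d : nat) (g : 'rV[R]_d -> \bar R) (g_concave : concave g).

Lemma concave_segment (u v : 'rV[R]_d) (r s a : R) : 0 <= a <= 1 ->
  (r%:E <= g u)%E -> (s%:E <= g v)%E ->
  ((a * r + (1 - a) * s)%:E <= g (a *: u + (1 - a) *: v))%E.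
Proof.
move=> /andP[]; rewrite le_eqVlt => /predU1P[<- _ _ sv|a0].
  by rewrite mul0r scale0r !add0r subr0 mul1r scale1r.
rewrite le_eqVlt => /predU1P[-> ru _|a1 ru sv].
  by rewrite subrr mul0r scale0r !addr0 mul1r scale1r.
apply: le_trans (g_concave u v a0 a1).
by rewrite EFinD !EFinM leeD// lee_pmul2l// lte_fin// subr_gt0.
Qed.

Lemma jensen (T : finType) (w f : T -> R) (p : T -> 'rV[R]_d) : distr w ->
    (forall t, ((f t)%:E <= g (p t))%E) ->
  ((\sum_t w t * f t)%:E <= g (\sum_t w t *: p t))%E.
Proof.
move=> [w0 w1] fp.
(* The induction carries a residual point [q] of mass [c]; each new point is merged with it into one
   point of mass [w t + c]. *)
have H (s : seq T) (c r : R) (q : 'rV[R]_d) : 0 <= c -> (r%:E <= g q)%E ->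
    \sum_(t <- s) w t + c = 1 ->
    ((\sum_(t <- s) w t * f t + c * r)%:E <=
      g (\sum_(t <- s) w t *: p t + c *: q))%E.
  elim: s c r q => [|t s IH] c r q c0 rq.
    by rewrite !big_nil !add0r => ->; rewrite mul1r scale1r.
  rewrite !big_cons addrAC addrC => sc1.
  have tc0 : 0 <= w t + c by rewrite addr_ge0.
  move: (tc0); rewrite le_eqVlt => /predU1P[|tc_gt0].
    move=> /esym/eqP; rewrite paddr_eq0// => /andP[/eqP wt0 /eqP c_eq0].
    have := IH 0 _ _ (lexx 0) rq; rewrite c_eq0 wt0 !mul0r !scale0r !addr0 !add0r.
    by apply; rewrite -sc1 wt0 c_eq0 !addr0.
  pose a := w t / (w t + c).
  have a01 : 0 <= a <= 1.
    by rewrite divr_ge0//= ler_pdivrMr// mul1r lerDl.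
  have E1 : w t = (w t + c) * a by rewrite /a mulrC divfK// gt_eqF.
  have E2 : c = (w t + c) * (1 - a) by rewrite mulrBr mulr1 -E1 addrC addKr.
  clearbody a; have := IH _ _ _ tc0 (concave_segment a01 (fp t) rq) sc1.
  rewrite mulrDr scalerDr !mulrA !scalerA -E1 -E2.
  by rewrite addrCA [X in g X]addrCA !addrA.
(* [T] is inhabited because the weights sum to 1; any of its points serves as initial residual, with
   mass 0. *)
have [t0] : exists t0 : T, true.
  case: (pickP (@predT T)) => [t _|T0]; first by exists t.
  by move: w1; rewrite big_pred0// => /esym/eqP; rewrite oner_eq0.
move=> _; have := H (index_enum T) 0 _ _ (lexx 0) (fp t0).
by rewrite mul0r scale0r !addr0 => ->.
Qed.

End Jensen.

(** * The tent function and distributions with a given barycenter *)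

Section TentRepresentation.
Context (R : realType) (d n : nat) (x : 'I_n -> 'rV[R]_d) (y : 'rV[R]_n).

(** Off the convex hull the supremum is over the empty set, hence [-oo]. *)
Let hull_value (u : 'rV[R]_d) : \bar R :=
  ereal_sup [set r%:E | r in [set r | exists2 w, distr w &
    u = \sum_i w i *: x i /\ r = \sum_i w i * y 0 i]].

(** Point masses give the bound at each [x i], and mixing distributions gives concavity. *)
Let hull_value_majorant : concave_majorant x y hull_value.
Proof.
have noty u : hull_value u != +oo%E.
  rewrite -ltey; apply: (@le_lt_trans _ _ (\sum_i `|y 0 i|)%:E); last exact: ltry.
  apply: ge_ereal_sup => _ [_ [w [w0 w1] [_ ->] <-]]; rewrite lee_fin.
  apply: ler_sum => i _; apply: le_trans (ler_norm _) _.
  rewrite normrM ler_piMl// ger0_norm// -w1 (bigD1 i)//= lerDl.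
  by rewrite sumr_ge0.
split => // [u v t t0 t1|i]; last first.
  apply: ereal_sup_ubound; exists (y 0 i) => //.
  exists (fun j => (j == i)%:R); first split => [j|].
  - by rewrite ler0n.
  - by rewrite (bigD1 i)//= eqxx big1 ?addr0// => j /negbTE ->.
  - split; rewrite (bigD1 i)//= eqxx big1 ?addr0 ?scale1r ?mul1r//.
      by move=> j /negbTE ->; rewrite scale0r.
    by move=> j /negbTE ->; rewrite mul0r.
have t1' : 0 < 1 - t by rewrite subr_gt0.
apply: lee_weighted_sum => // r s.
move=> /ereal_sup_gt[_ [_ [w [w0 w1] [-> ->] <-]]]; rewrite lte_fin => /ltW rw.
move=> /ereal_sup_gt[_ [_ [w' [w'0 w'1] [-> ->] <-]]]; rewrite lte_fin => /ltW sw.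
apply: (@le_trans _ _ (\sum_i (t * w i + (1 - t) * w' i) * y 0 i)%:E).
  rewrite lee_fin; under eq_bigr do rewrite mulrDl -!mulrA.
  by rewrite big_split/= -!mulr_sumr lerD// ler_pM2l.
apply: ereal_sup_ubound; eexists; last reflexivity.
exists (fun i => t * w i + (1 - t) * w' i); first split => [i|].
- by rewrite addr_ge0// mulr_ge0// ltW.
- by rewrite big_split/= -!mulr_sumr w1 w'1 !mulr1 addrC subrK.
- split => //; under [RHS]eq_bigr do rewrite scalerDl -!scalerA.
  by rewrite big_split/= !scaler_sumr.
Qed.

Lemma lt_tent (u : 'rV[R]_d) (r : R) : (r%:E < tent x y u)%E ->
  exists2 w, distr w & u = \sum_i w i *: x i /\ r < \sum_i w i * y 0 i.
Proof.
move=> /lt_le_trans/(_ (tent_smallest u hull_value_majorant)).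
move=> /ereal_sup_gt[_ [_ [w wd [-> ->] <-]]]; rewrite lte_fin => rw.
by exists w.
Qed.

End TentRepresentation.

(** * Extremal distributions under moment constraints, and uncrossing *)

Lemma max_with_moments (R : realType) (T : finType) (K : Type) (Z : K -> T -> R)
    (Y S : T -> R) (w0 : T -> R) : distr w0 ->
  exists2 w, [/\ distr w, forall k, \sum_t w t * Z k t = \sum_t w0 t * Z k t &
      \sum_t w0 t * Y t <= \sum_t w t * Y t] &
    forall w', distr w' ->
      (forall k, \sum_t w' t * Z k t = \sum_t w0 t * Z k t) ->
      \sum_t w0 t * Y t <= \sum_t w' t * Y t ->
    \sum_t w' t * S t <= \sum_t w t * S t.
Proof.
move=> w0d.
pose ev (f : T -> R) (p : 'rV[R]_#|T|) := \sum_t p 0 (enum_rank t) * f t.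
have ev_cont f : continuous (ev f).
  apply: (@continuous_big R^o) => [|t _]; first exact: pseudometric_normed_Zmodule.add_continuous.
  have H : continuous (fun p : 'rV[R]_#|T| => p 0 (enum_rank t) * f t).
    move=> p; apply: (@cvgMr_tmp R _ (nbhs p) _
      (fun p : 'rV[R]_#|T| => p 0 (enum_rank t))).
    exact: coord_continuous.
  exact: H.
pose row (w : T -> R) : 'rV[R]_#|T| := \row_i w (enum_val i).
have ev_row f w : ev f (row w) = \sum_t w t * f t.
  by apply: eq_bigr => t _; rewrite mxE enum_rankK.
pose M k := [set p | ev (Z k) p = \sum_t w0 t * Z k t].
(* The admissible distributions, as row vectors: a closed subset of the unit cube, hence compact, on
   which the continuous [ev S] attains its maximum. *)
pose A := [set p : 'rV[R]_#|T| | forall i, p 0 i \in `[0, 1]] `&`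
  ([set p | ev (fun=> 1) p = 1] `&` ((\bigcap_k M k) `&`
   [set p | \sum_t w0 t * Y t <= ev Y p])).
have A_row w : distr w -> (forall k, \sum_t w t * Z k t = \sum_t w0 t * Z k t) ->
    \sum_t w0 t * Y t <= \sum_t w t * Y t -> A (row w).
  move=> [w_ge0 w1] wZ wY; split; last split; last split.
  - move=> i; rewrite mxE in_itv/= w_ge0/= -w1 (bigD1 (enum_val i))//= lerDl.
    by rewrite sumr_ge0.
  - by rewrite /= ev_row; under eq_bigr do rewrite mulr1.
  - by move=> k _; rewrite /M/= ev_row.
  - by rewrite /= ev_row.
have closed_ev f (D : set R) : closed D -> closed (ev f @^-1` D).
  by apply: preimage_closed => p _; exact: ev_cont.
have cA : compact A.
  apply: compact_closedI; first exact: (rV_compact (fun=> @segment_compact R 0 1)).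
  apply: closedI; last apply: closedI.
  - exact: (closed_ev _ [set r | r = 1] (@closed_eq _ _)).
  - apply: closed_bigI => k _.
    exact: (closed_ev _ [set r | r = _] (@closed_eq _ _)).
  - exact: (closed_ev _ [set r | _ <= r] (@closed_ge _ _)).
have A0 : A !=set0 by exists (row w0); exact: A_row.
have [|p /set_mem[p01 [p1 [pZ pY]]] pmax] := @EVT_max_rV _ _ (ev S) A A0 cA.
  by apply: continuous_subspaceT; exact: ev_cont.
exists (fun t => p 0 (enum_rank t)).
  split => //; last by move=> k; exact: pZ.
  split => [t|]; first by have := p01 (enum_rank t); rewrite in_itv/= => /andP[].
  by rewrite -[RHS]p1; apply: eq_bigr => t _; rewrite mulr1.
move=> w' w'd w'Z w'Y; rewrite -ev_row; apply: pmax.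
by apply: mem_set; exact: A_row.
Qed.

Lemma sum_delta (R : realType) (T : finType) (f : T -> R) (s : T) :
  \sum_r (r == s)%:R * f r = f s.
Proof.
rewrite (bigD1 s)//= eqxx mul1r big1 ?addr0// => r /negbTE ->.
by rewrite mul0r.
Qed.

(* A maximizer of the second moment of the size [sz] has chain support: moving
   mass from an incomparable pair to its meet and join would increase it. *)
Lemma uncrossing (R : realType) (T K : finType) (Z : K -> T -> R) (Y : T -> R)
    (m j : T -> T -> T) (w0 : T -> R) :
    (forall k s t, Z k (m s t) <= Z k s /\ Z k (m s t) <= Z k t) ->
    (forall k s t, Z k (m s t) + Z k (j s t) = Z k s + Z k t) ->
    (forall s t, Y s + Y t <= Y (m s t) + Y (j s t)) ->
    distr w0 ->
  exists w, [/\ distr w, forall k, \sum_t w t * Z k t = \sum_t w0 t * Z k t,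
      \sum_t w0 t * Y t <= \sum_t w t * Y t &
      forall s t, 0 < w s -> 0 < w t ->
        (forall k, Z k s <= Z k t) \/ (forall k, Z k t <= Z k s)].
Proof.
move=> Zm Zmj Ymj w0d; pose sz t := \sum_k Z k t.
have [w [wd wZ wY] wmax] := max_with_moments Z Y (fun t => sz t ^+ 2) w0d.
exists w; split => // s t ws wt.
have [->|s_neq_t] := eqVneq s t; first by left.
(* The largest mass that can leave both [s] and [t] while the weights stay nonnegative. *)
pose e := Num.min (w s) (w t).
have e0 : 0 < e by rewrite lt_min ws wt.
pose w' r := w r + e * ((r == m s t)%:R + (r == j s t)%:R
                        - (r == s)%:R - (r == t)%:R).
have w'E f : \sum_r w' r * f r =
    \sum_r w r * f r + e * (f (m s t) + f (j s t) - f s - f t).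
  under eq_bigr do rewrite mulrDl -mulrA !mulrDl !mulNr.
  by rewrite big_split/= -mulr_sumr !big_split/= !sumrN !sum_delta.
have w'd : distr w'.
  have [w_ge0 w1] := wd; split => [r|].
    have [es et] : e <= w s /\ e <= w t by rewrite !ge_min !lexx orbT.
    apply: (@le_trans _ _ (w r - e * ((r == s)%:R + (r == t)%:R))).
      rewrite subr_ge0; have [rs|_] := eqVneq r s.
        by rewrite rs (negbTE s_neq_t) addr0 mulr1.
      by have [->|_] := eqVneq r t; rewrite add0r ?mulr1// mulr0.
    rewrite /w' lerD2l -mulrN ler_pM2l// opprD -[leRHS]addrA lerDr.
    by rewrite addr_ge0// ler0n.
  have := w'E (fun=> 1); under eq_bigr do rewrite mulr1.
  under [X in _ = X + _ -> _]eq_bigr do rewrite mulr1.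
  by rewrite addrK subrr mulr0 addr0 w1.
have w'Z k : \sum_r w' r * Z k r = \sum_r w0 r * Z k r.
  by rewrite w'E Zmj -addrA -opprD subrr mulr0 addr0 wZ.
have w'Y : \sum_r w0 r * Y r <= \sum_r w' r * Y r.
  by rewrite w'E (le_trans wY)// lerDl mulr_ge0 ?(ltW e0)// -addrA -opprD subr_ge0.
have := wmax w' w'd w'Z w'Y; rewrite w'E gerDl pmulr_rle0//.
have szmj : sz (m s t) + sz (j s t) = sz s + sz t.
  by rewrite -!big_split; apply: eq_bigr => k _; exact: Zmj.
have szj : sz (j s t) = sz s + sz t - sz (m s t) by rewrite -szmj addrC addKr.
(* The gain in second moment is twice a product of nonnegative factors; maximality makes one factor
   vanish. *)
have -> : sz (m s t) ^+ 2 + sz (j s t) ^+ 2 - sz s ^+ 2 - sz t ^+ 2 =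
    ((sz s - sz (m s t)) * (sz t - sz (m s t))) *+ 2 by rewrite szj; ring.
(* A vanishing factor is a zero sum of nonnegative terms, so [r] agrees with the meet in every
   [Z k], which makes [s] and [t] comparable. *)
have szm r : (forall k, Z k (m s t) <= Z k r) ->
    0 <= sz r - sz (m s t) /\
    (sz r - sz (m s t) = 0 -> forall k, Z k r = Z k (m s t)).
  move=> Zr; rewrite /sz -sumrB; split.
    by apply: sumr_ge0 => k _; rewrite subr_ge0.
  move=> /eqP; rewrite psumr_eq0 => [/allP H k|k _]; last by rewrite subr_ge0.
  by apply/eqP; rewrite -subr_eq0; apply: H; rewrite mem_index_enum.
have [s_ge0 s0] := szm s (fun k => (Zm k s t).1).
have [t_ge0 t0] := szm t (fun k => (Zm k s t).2).
rewrite pmulrn_lle0// => st_le0.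
have /eqP : (sz s - sz (m s t)) * (sz t - sz (m s t)) = 0.
  by apply/eqP; rewrite eq_le st_le0 mulr_ge0.
rewrite mulf_eq0 => /orP[] /eqP => [/s0|/t0] E.
  by left => k; rewrite E; exact: (Zm k s t).2.
by right => k; rewrite E; exact: (Zm k s t).1.
Qed.

(** * Coordinatewise minima, and convex combinations of three points *)

Lemma vminDmax (R : realType) (d : nat) (u v : 'rV[R]_d) :
  vmin u v + vmax u v = u + v.
Proof. by apply/rowP => k; rewrite !mxE addrC addr_max_min. Qed.

Lemma vminC (R : realType) (d : nat) (u v : 'rV[R]_d) : vmin u v = vmin v u.
Proof. by apply/rowP => k; rewrite !mxE minC. Qed.

Lemma sum_scale_coord (R : realType) (d : nat) (T : finType) (w : T -> R)
    (p : T -> 'rV[R]_d) k :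
  (\sum_t w t *: p t) 0 k = \sum_t w t * p t 0 k.
Proof. by rewrite summxE; apply: eq_bigr => t _; rewrite mxE. Qed.

(* In the plane, subtracting the positive quadrant from [vmin u v] lands in the
   region cut off behind it by the antidiagonal from [u] to [v]. *)
Lemma planar_hull (R : realType) (u v a : 'rV[R]_2) :
    (forall k, a 0 k <= vmin u v 0 k) ->
  exists w1 w2 w3 : R, [/\ 0 <= w1, 0 <= w2, 0 <= w3, w1 + w2 + w3 = 1 &
    vmin u v = w1 *: u + w2 *: v + w3 *: a].
Proof.
have ord2 (k : 'I_2) : k = 0 \/ k = 1.
  by case: k => [[|[|//]] Hk]; [left|right]; exact: val_inj.
wlog uv0 : u v / u 0 0 <= v 0 0.
  move=> H; have [/H//|/ltW /H Hvu] := leP (u 0 0) (v 0 0).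
  rewrite vminC => /Hvu[w1 [w2 [w3 [w1_ge0 w2_ge0 w3_ge0 w_sum ->]]]].
  exists w2, w1, w3; split=> //; first by rewrite [w2 + _]addrC.
  by rewrite [w2 *: _ + _]addrC.
(* If [u] and [v] are comparable, their minimum is one of them. *)
move=> av; have [uv1|vu1] := leP (u 0 1) (v 0 1).
  exists 1, 0, 0; split; rewrite ?addr0// !scale0r scale1r !addr0.
  by apply/rowP => k; rewrite mxE; apply/min_idPl; case: (ord2 k) => ->.
move: uv0; rewrite le_eqVlt => /predU1P[uv0e|uv0].
  exists 0, 1, 0; split; rewrite ?addr0 ?add0r// !scale0r scale1r add0r addr0.
  apply/rowP => k; rewrite mxE; apply/min_idPr.
  by case: (ord2 k) => ->; rewrite ?uv0e// ltW.
have au := av 0; have a1 := av 1.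
move: au a1; rewrite !mxE (min_idPl (ltW uv0)) (min_idPr (ltW vu1)) => a0 a1.
have d0 : 0 < v 0 0 - u 0 0 by rewrite subr_gt0.
have d1 : 0 < u 0 1 - v 0 1 by rewrite subr_gt0.
(* With the corner [vmin u v] as origin and the rectangle's sides as units, [u], [v], [a] become
   (0,1), (1,0), (-A,-B). Thus [B], [A], [1] are weights with barycenter at the corner, up to the
   factor [1 + A + B]. *)
pose A := (u 0 0 - a 0 0) / (v 0 0 - u 0 0).
pose B := (v 0 1 - a 0 1) / (u 0 1 - v 0 1).
have A0 : 0 <= A by rewrite divr_ge0 ?subr_ge0// ltW.
have B0 : 0 <= B by rewrite divr_ge0 ?subr_ge0// ltW.
have AB0 : 0 < 1 + A + B by rewrite ltr_wpDr// ltr_wpDr.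
have AE : A * (v 0 0 - u 0 0) = u 0 0 - a 0 0 by rewrite divfK// gt_eqF.
have BE : B * (u 0 1 - v 0 1) = v 0 1 - a 0 1 by rewrite divfK// gt_eqF.
have aE0 : a 0 0 = u 0 0 - A * (v 0 0 - u 0 0) by rewrite AE; ring.
have aE1 : a 0 1 = v 0 1 - B * (u 0 1 - v 0 1) by rewrite BE; ring.
clearbody A B.
exists (B / (1 + A + B)), (A / (1 + A + B)), (1 + A + B)^-1; split.
- by rewrite divr_ge0// ltW.
- by rewrite divr_ge0// ltW.
- by rewrite invr_ge0 ltW.
- by field; rewrite gt_eqF.
- apply/rowP => k; rewrite !mxE; case: (ord2 k) => ->.
    by rewrite (min_idPl (ltW uv0)) aE0; field; rewrite gt_eqF.
  by rewrite (min_idPr (ltW vu1)) aE1; field; rewrite gt_eqF.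
Qed.

Lemma concave3 (R : realType) (d : nat) (g : 'rV[R]_d -> \bar R)
    (u v p : 'rV[R]_d) (r s q w1 w2 w3 : R) :
    concave g -> 0 <= w1 -> 0 <= w2 -> 0 <= w3 -> w1 + w2 + w3 = 1 ->
    (r%:E <= g u)%E -> (s%:E <= g v)%E -> (q%:E <= g p)%E ->
  ((w1 * r + w2 * s + w3 * q)%:E <= g (w1 *: u + w2 *: v + w3 *: p)%R)%E.
Proof.
move=> g_concave w1_ge0 w2_ge0 w3_ge0 w_sum ru sv qp.
have := @jensen _ _ g g_concave 'I_3 (fun i => nth 0 [:: w1; w2; w3] i)
  (fun i => nth 0 [:: r; s; q] i) (fun i => nth 0 [:: u; v; p] i).
rewrite !big_ord_recr !big_ord0/= !add0r; apply.
  split; last by rewrite !big_ord_recr big_ord0/= add0r.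
  by case=> [[|[|[|]]]].
by case=> [[|[|[|]]]].
Qed.

(** * Independent couplings and expectations of minima *)

Section ProductDistr.
Context (R : realType) (I J : finType) (w : I -> R) (w' : J -> R).
Hypotheses (wd : distr w) (w'd : distr w').

Lemma sum_prodl (F : I -> R) :
  \sum_(t : I * J) w t.1 * w' t.2 * F t.1 = \sum_i w i * F i.
Proof.
rewrite -(pair_bigA _ (fun i j => w i * w' j * F i))/=.
apply: eq_bigr => i _; rewrite -mulr_suml -mulr_sumr.
by rewrite w'd.2 mulr1.
Qed.

Lemma sum_prodr (F : J -> R) :
  \sum_(t : I * J) w t.1 * w' t.2 * F t.2 = \sum_j w' j * F j.
Proof.
rewrite -(pair_bigA _ (fun i j => w i * w' j * F j))/= exchange_big/=.
apply: eq_bigr => j _; under eq_bigr do rewrite -mulrA.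
by rewrite -mulr_suml wd.2 mul1r.
Qed.

Lemma distr_prod : distr (fun t : I * J => w t.1 * w' t.2).
Proof.
split=> [t|]; first by rewrite mulr_ge0 ?wd.1 ?w'd.1.
have := sum_prodl (fun=> 1); under eq_bigr do rewrite mulr1.
by move=> ->; under eq_bigr do rewrite mulr1; exact: wd.2.
Qed.

End ProductDistr.

(** One of [p], [q] dominates on the whole support of [w], so the minimum selects the same function
    before and after summation. *)
Lemma sum_min_comonotone (R : realType) (T : finType) (w p q : T -> R) :
    (forall t, 0 <= w t) ->
    (forall s t, 0 < w s -> 0 < w t -> q s < p s -> q t <= p t) ->
  \sum_t w t * Num.min (p t) (q t) =
    Num.min (\sum_t w t * p t) (\sum_t w t * q t).
Proof.
move=> w0 pq.
have sum_le f g : (forall t, 0 < w t -> f t <= g t) ->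
    \sum_t w t * f t <= \sum_t w t * g t.
  move=> fg; apply: ler_sum => t _; have := w0 t; rewrite le_eqVlt.
  by move=> /predU1P[<-|wt]; rewrite ?mul0r// ler_pM2l// fg.
have [[s [ws qps]]|npq] := pselect (exists s, 0 < w s /\ q s < p s).
  have qp t : 0 < w t -> q t <= p t by move=> wt; exact: pq qps.
  rewrite (min_idPr (sum_le _ _ qp)).
  by apply/eqP; rewrite eq_le !sum_le// => t wt; rewrite (min_idPr (qp t wt)).
have qp t : 0 < w t -> p t <= q t.
  by move=> wt; rewrite leNgt; apply/negP => qpt; apply: npq; exists t.
rewrite (min_idPl (sum_le _ _ qp)).
by apply/eqP; rewrite eq_le !sum_le// => t wt; rewrite (min_idPl (qp t wt)).
Qed.

(** * Supermodularity of the tent function *)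

Section MinmaxClosed.
Context (R : realType) (d n : nat) (x : 'I_n -> 'rV[R]_d) (y : 'rV[R]_n).
Hypotheses (x_closed : minmax_closed (range x)) (y_super : supermodular_vec x y).

(** Uncrossing needs meet and join as operations on indices; they are chosen from the closure of the
    range. *)
Lemma minmax_index : exists m j : 'I_n -> 'I_n -> 'I_n,
  forall a b, x (m a b) = vmin (x a) (x b) /\ x (j a b) = vmax (x a) (x b).
Proof.
have H (t : 'I_n * 'I_n) : exists kl : 'I_n * 'I_n,
    x kl.1 = vmin (x t.1) (x t.2) /\ x kl.2 = vmax (x t.1) (x t.2).
  have [[k _ xk] [l _ xl]] := x_closed (ex_intro2 _ _ t.1 I erefl : range x _)
    (ex_intro2 _ _ t.2 I erefl : range x _).
  by exists (k, l).
have [f fP] := choice H.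
exists (fun a b => (f (a, b)).1), (fun a b => (f (a, b)).2) => a b.
exact: (fP (a, b)).
Qed.

(** Jensen bounds the tent below by the averages of [y] over meets and over joins; supermodularity
    of [y] compares these with the pairs one at a time. *)
Lemma tent_coupling (w : 'I_n * 'I_n -> R) : distr w ->
  exists r s, [/\ (r%:E <= tent x y (\sum_t w t *: vmin (x t.1) (x t.2)))%E,
      (s%:E <= tent x y (\sum_t w t *: vmax (x t.1) (x t.2)))%E &
      \sum_t w t * (y 0 t.1 + y 0 t.2) <= r + s].
Proof.
move=> wd; have [m [j mj]] := minmax_index.
have [_ tc ty] := tent_majorant x y.
exists (\sum_t w t * y 0 (m t.1 t.2)), (\sum_t w t * y 0 (j t.1 t.2)).
split; [apply: jensen => // t..|].
- by rewrite -(mj t.1 t.2).1.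
- by rewrite -(mj t.1 t.2).2.
- rewrite -big_split; apply: ler_sum => t _ /=; rewrite -mulrDr.
  by rewrite ler_wpM2l ?wd.1// y_super// ?(mj _ _).1 ?(mj _ _).2.
Qed.

(** Tent values at [u] and [v] are approximated from below by distributions with these
    barycenters. *)
Lemma supermodular_tent :
    (forall w w', distr w -> distr w' ->
      let u := \sum_i w i *: x i in let v := \sum_i w' i *: x i in
      exists r s, [/\ (r%:E <= tent x y (vmin u v))%E,
        (s%:E <= tent x y (vmax u v))%E &
        \sum_i w i * y 0 i + \sum_i w' i * y 0 i <= r + s]) ->
  supermodular (tent x y).
Proof.
move=> H u v; have [noty _ _] := tent_majorant x y.
rewrite -[X in (X + _ <= _)%E]mul1e -[X in (_ + X <= _)%E]mul1e.
apply: lee_weighted_sum => // a b.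
move=> /lt_tent[w wd [-> aw]] /lt_tent[w' w'd [-> bw']].
have [r [s [rP sP wrs]]] := H w w' wd w'd.
apply: le_trans (leeD rP sP); rewrite -EFinD lee_fin !mul1r.
by apply: le_trans wrs; rewrite lerD// ltW.
Qed.

Lemma supermodular_tent_planar : d = 2 -> supermodular (tent x y).
Proof.
move=> d2; apply: supermodular_tent => w w' wd w'd u v.
pose pi (t : 'I_n * 'I_n) := w t.1 * w' t.2.
have pi_d : distr pi by exact: distr_prod.
have [r [s [rP sP]]] := tent_coupling pi_d.
have -> : \sum_t pi t * (y 0 t.1 + y 0 t.2) =
    \sum_i w i * y 0 i + \sum_i w' i * y 0 i.
  under eq_bigr do rewrite mulrDr.
  by rewrite big_split/= (sum_prodl _ w'd (fun i => y 0 i))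
    (sum_prodr _ wd (fun i => y 0 i)).
set a := \sum_t _ in rP; set b := \sum_t _ in sP.
have uE k : \sum_t pi t * x t.1 0 k = u 0 k.
  by rewrite (sum_prodl _ w'd (fun i => x i 0 k)) sum_scale_coord.
have vE k : \sum_t pi t * x t.2 0 k = v 0 k.
  by rewrite (sum_prodr _ wd (fun i => x i 0 k)) sum_scale_coord.
have abE : a + b = u + v.
  rewrite -big_split/=; under eq_bigr do rewrite -scalerDr vminDmax scalerDr.
  rewrite big_split/=; congr (_ + _); apply/rowP => k.
    by rewrite sum_scale_coord uE.
  by rewrite sum_scale_coord vE.
have a_le k : a 0 k <= vmin u v 0 k.
  rewrite mxE le_min -uE -vE sum_scale_coord.
  by apply/andP; split; apply: ler_sum => t _;
    rewrite ler_wpM2l ?pi_d.1// mxE ge_min lexx ?orbT.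
have [w1 [w2 [w3 [w1_ge0 w2_ge0 w3_ge0 w_sum uvE]]]] : exists w1 w2 w3 : R,
    [/\ 0 <= w1, 0 <= w2, 0 <= w3, w1 + w2 + w3 = 1 &
      vmin u v = w1 *: u + w2 *: v + w3 *: a].
  by move: (u) (v) (a) a_le; rewrite d2 => *; exact: planar_hull.
(* The reflection [p |-> u + v - p] swaps [u] with [v], [a] with [b] and the minimum with the
   maximum, so the same weights apply. *)
have uvE' : vmax u v = w1 *: v + w2 *: u + w3 *: b.
  have -> : vmax u v = u + v - vmin u v by rewrite -(vminDmax u v) addrC addKr.
  have -> : b = u + v - a by rewrite -abE addrC addKr.
  rewrite uvE -[in LHS](scale1r (u + v)) -w_sum; apply/rowP => k.
  by rewrite !mxE; ring.
have [_ tc ty] := tent_majorant x y.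
have ru : ((\sum_i w i * y 0 i)%:E <= tent x y u)%E by exact: jensen.
have sv : ((\sum_i w' i * y 0 i)%:E <= tent x y v)%E by exact: jensen.
move: ru sv; set ru := \sum_i _; set sv := \sum_i _ => uP vP rs.
exists (w1 * ru + w2 * sv + w3 * r), (w1 * sv + w2 * ru + w3 * s); split.
- by rewrite uvE; exact: concave3.
- by rewrite uvE'; exact: concave3.
(* The weights [w1] and [w2] together reproduce [(w1 + w2) * (ru + sv)]; only the [w3] share of the
   coupling's gain remains. *)
- rewrite -subr_ge0 (_ : _ - _ = w3 * (r + s - (ru + sv))).
    by rewrite mulr_ge0// subr_ge0.
  have -> : w3 = 1 - w1 - w2 by rewrite -w_sum; ring.
  ring.
Qed.

(* On a chain of pairs in a two-valued lattice, the sign of the difference of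
   the k-th coordinates is constant, so expectation and minimum commute. *)
Lemma supermodular_tent_binary (a b : 'rV[R]_d) : (forall k, a 0 k <= b 0 k) ->
    (forall i k, x i 0 k = a 0 k \/ x i 0 k = b 0 k) ->
  supermodular (tent x y).
Proof.
move=> ab xab; apply: supermodular_tent => w w' wd w'd u v.
have [m [j mj]] := minmax_index.
(* A pair of points is read as a vector of 2d coordinates, so that a chain is one for the product
   order on pairs. *)
pose Z (k : 'I_d + 'I_d) (t : 'I_n * 'I_n) :=
  match k with inl k => x t.1 0 k | inr k => x t.2 0 k end.
pose mm (s t : 'I_n * 'I_n) := (m s.1 t.1, m s.2 t.2).
pose jj (s t : 'I_n * 'I_n) := (j s.1 t.1, j s.2 t.2).
have [k s t|k s t|s t||pi [pi_d piZ piY pi_chain]] :=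
    @uncrossing _ _ _ Z (fun t => y 0 t.1 + y 0 t.2) mm jj
      (fun t => w t.1 * w' t.2).
- by case: k => k; rewrite /Z/= (mj _ _).1 mxE !ge_min !lexx orbT.
- by case: k => k; rewrite /Z/= (mj _ _).1 (mj _ _).2 -[RHS]addr_max_min !mxE addrC.
- rewrite addrACA [leRHS]addrACA.
  by rewrite lerD// y_super ?(mj _ _).1 ?(mj _ _).2.
- exact: distr_prod.
have uE k : \sum_t pi t * x t.1 0 k = u 0 k.
  by rewrite (piZ (inl k)) (sum_prodl _ w'd (fun i => x i 0 k)) sum_scale_coord.
have vE k : \sum_t pi t * x t.2 0 k = v 0 k.
  by rewrite (piZ (inr k)) (sum_prodr _ wd (fun i => x i 0 k)) sum_scale_coord.
have minE : \sum_t pi t *: vmin (x t.1) (x t.2) = vmin u v.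
  apply/rowP => k; rewrite sum_scale_coord [RHS]mxE -uE -vE.
  under eq_bigr do rewrite mxE.
  apply: sum_min_comonotone => [|s t ps pt sk]; first exact: pi_d.1.
  (* By [sk], the k-th coordinates of the pair [s] are [b] first and [a] second. Going up the chain
     keeps the first at the top value [b]; going down keeps the second at the bottom value [a]. *)
  have [st|ts] := pi_chain _ _ ps pt.
    have := st (inl k); rewrite /Z; have := ab k; move: sk.
    by case: (xab s.1 k) (xab s.2 k) (xab t.1 k) (xab t.2 k)
      => -> [] -> [] -> [] ->; lra.
  have := ts (inr k); rewrite /Z; have := ab k; move: sk.
  by case: (xab s.1 k) (xab s.2 k) (xab t.1 k) (xab t.2 k)
    => -> [] -> [] -> [] ->; lra.
have maxE : \sum_t pi t *: vmax (x t.1) (x t.2) = vmax u v.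
  apply: (addrI (vmin u v)); rewrite vminDmax -minE -big_split/=.
  under eq_bigr do rewrite -scalerDr vminDmax scalerDr.
  rewrite big_split/=; congr (_ + _); apply/rowP => k.
    by rewrite sum_scale_coord uE.
  by rewrite sum_scale_coord vE.
have := tent_coupling pi_d; rewrite minE maxE => -[r [s [rP sP rs]]].
exists r, s; split=> //; apply: le_trans rs; apply: le_trans piY.
rewrite le_eqVlt; apply/orP; left; apply/eqP.
under [RHS]eq_bigr do rewrite mulrDr.
by rewrite big_split/= (sum_prodl _ w'd (fun i => y 0 i))
  (sum_prodr _ wd (fun i => y 0 i)).
Qed.

End MinmaxClosed.

Theorem theorem3p4 (R : realType) (d n : nat) (x : 'I_n -> 'rV[R]_d)
    (x_inj : injective x) (x_closed : minmax_closed (range x))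
    (hX : d = 2%N \/
      exists a b : 'rV[R]_d, (forall i, a 0 i <= b 0 i) /\
        range x `<=` [set u : 'rV[R]_d | forall i, u 0 i = a 0 i \/ u 0 i = b 0 i]) :
  MTP2_tidy x.
Proof.
move=> y _ y_super.
case: hX => [d2|[a [b [ab xab]]]]; first exact: supermodular_tent_planar.
by apply: (supermodular_tent_binary x_closed y_super ab) => i; apply: xab; exists i.
Qed.
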